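(* Let $X \subseteq \mathbb{R}^n$ be nonempty and closed, let $f \colon \mathbb{R}^n \to \mathbb{R}$ be continuously differentiable, let $\rho > 0$, and let $p^\rho(y) = \sum_{i=1}^n p_i^\rho(y_i)$, where each $p_i^\rho \colon \mathbb{R} \to \mathbb{R}$ satisfies (P.1)--(P.3) stated in the context. Consider the problems (SPO): $\min_x f(x) + \rho \|x\|_0$ subject to $x \in X$, (SPOref): $\min_{x,y} f(x) + p^\rho(y)$ subject to $x \in X$, $x \circ y = 0$. A point $x^* \in X$ is a global minimum of (SPO) if and only if $(x^*, y^* )$ is a global minimum of (SPOref), where $y^* \in \mathbb{R}^n$ is given by $y_i^* = s_i^\rho$ for $i \in I_0(x^* )$ and $y_i^* = 0$ otherwise.
   Context: Notation: $\|x\|_0$ is the number of nonzero components of $x \in \mathbb{R}^n$; $I_0(x) := \{ i \mid x_i = 0 \}$; $x \circ y$ is the componentwise (Hadamard) product. Conditions on the functions $p_i^\rho \colon \mathbb{R} \to \mathbb{R}$, $i = 1,\dots,n$: (P.1) $p_i^\rho$ is convex and attains a unique minimum (possibly depending on $\rho$) at some point $s_i^\rho > 0$; (P.2) $p_i^\rho(0) - p_i^\rho(s_i^\rho) = \rho$; (P.3) $p_i^\rho$ is sufficiently smooth; here only continuity is required. *)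

(* Defs.v *)
From HB Require Import structures.
From mathcomp Require Import all_boot all_order all_algebra.
From mathcomp Require Import boolp classical_sets reals topology normedtype.
From mathcomp Require Import derive convex.

Set Implicit Arguments.
Unset Strict Implicit.
Unset Printing Implicit Defensive.

Import Order.TTheory GRing.Theory Num.Theory.
Import numFieldNormedType.Exports.

Local Open Scope classical_set_scope.
Local Open Scope ring_scope.

Definition is_global_min (R : realType) (T : Type) (C : set T) (F : T -> R)
    (z : T) : Prop :=
  C z /\ forall w, C w -> F z <= F w.

Definition is_unique_global_min (R : realType) (T : Type) (C : set T)
    (F : T -> R) (z : T) : Prop :=
  is_global_min C F z /\ forall w, is_global_min C F w -> w = z.

Definition gradient (R : realType) (n : nat) (f : 'rV[R]_n -> R)
    (x : 'rV[R]_n) : 'rV[R]_n :=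
  \row_i 'D_(delta_mx 0 i) f x.

Definition continuously_differentiable (R : realType) (n : nat)
    (f : 'rV[R]_n -> R) : Prop :=
  (forall x, differentiable f x) /\ continuous (gradient f).

Definition I0 (R : realType) (n : nat) (x : 'rV[R]_n) : {set 'I_n} :=
  [set i | x 0 i == 0]%SET.

Definition norm0 (R : realType) (n : nat) (x : 'rV[R]_n) : nat :=
  #|[set i | x 0 i != 0]%SET|.

Definition hadamard (R : realType) (n : nat) (x y : 'rV[R]_n) : 'rV[R]_n :=
  map2_mx *%R x y.

(* Here p and s stand for p_i^rho and s_i^rho: rho is fixed, so their dependence
   on it is left implicit. *)
Definition P1 (R : realType) (p : R -> R) (s : R) : Prop :=
  [/\ convex_function setT (p : R^o -> R^o), is_unique_global_min setT p s
    & 0 < s].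

Definition P2 (R : realType) (rho : R) (p : R -> R) (s : R) : Prop :=
  p 0 - p s = rho.

Definition P3 (R : realType) (p : R -> R) : Prop := continuous p.

Definition SPO_objective (R : realType) (n : nat) (f : 'rV[R]_n -> R) (rho : R)
    (x : 'rV[R]_n) : R :=
  f x + rho * (norm0 x)%:R.

Definition SPO_solution (R : realType) (n : nat) (X : set 'rV[R]_n)
    (f : 'rV[R]_n -> R) (rho : R) (x : 'rV[R]_n) : Prop :=
  is_global_min X (SPO_objective f rho) x.

Definition penalty (R : realType) (n : nat) (p : 'I_n -> R -> R)
    (y : 'rV[R]_n) : R :=
  \sum_i p i (y 0 i).

Definition SPOref_feasible (R : realType) (n : nat) (X : set 'rV[R]_n) :
    set ('rV[R]_n * 'rV[R]_n) :=
  [set xy | X xy.1 /\ hadamard xy.1 xy.2 = 0].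

Definition SPOref_objective (R : realType) (n : nat) (f : 'rV[R]_n -> R)
    (p : 'I_n -> R -> R) (xy : 'rV[R]_n * 'rV[R]_n) : R :=
  f xy.1 + penalty p xy.2.

Definition SPOref_solution (R : realType) (n : nat) (X : set 'rV[R]_n)
    (f : 'rV[R]_n -> R) (p : 'I_n -> R -> R) (x y : 'rV[R]_n) : Prop :=
  is_global_min (SPOref_feasible X) (SPOref_objective f p) (x, y).

Definition ystar (R : realType) (n : nat) (s : 'I_n -> R) (x : 'rV[R]_n) :
    'rV[R]_n :=
  \row_i (if i \in I0 x then s i else 0).

(* Main.v *)
Require Import Defs.
From HB Require Import structures.
From mathcomp Require Import all_boot all_order all_algebra.
From mathcomp Require Import boolp classical_sets reals topology normedtype.
From mathcomp Require Import derive convex.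

Import Order.TTheory GRing.Theory Num.Theory.
Import numFieldNormedType.Exports.

Local Open Scope classical_set_scope.
Local Open Scope ring_scope.

(** For fixed x, the constraint [hadamard x y = 0] leaves y_i free where x_i = 0
    and forces y_i = 0 where x_i <> 0.  Since the penalty is separable, its
    minimum over the admissible y is reached by choosing each free y_i at the
    minimizer s_i, that is, at [ystar s x].  A forced coordinate costs
    p_i(0) = p_i(s_i) + rho, so this minimum equals
    sum_i p_i(s_i) + rho * ||x||_0: a constant independent of x plus the l0
    term.  Minimizing the reformulated objective over y for fixed x thus gives
    back the original objective up to an additive constant
    ([penalty_ge], [penalty_ystar]), and the equivalence is an instance of the
    principle of partial minimization ([partial_min_global_min]). *)

(** Partial minimization: F + c is the infimum of G over the fibre of D above
    each point of C, and h selects a point of the fibre where it is reached. *)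
Lemma partial_min_global_min {R : realType} {T U : Type} {C : set T}
    {D : set (T * U)} {F : T -> R} {G : T * U -> R} (h : T -> U) (c : R) {z : T}
    (D_fst : forall x y, D (x, y) -> C x)
    (D_h : forall x, C x -> D (x, h x))
    (G_ge : forall x y, D (x, y) -> F x + c <= G (x, y))
    (G_h : forall x, C x -> G (x, h x) = F x + c) :
  is_global_min C F z <-> is_global_min D G (z, h z).
Proof.
split=> [[Cz minz]|[/D_fst Cz minz]].
  split=> [|[x y] Dxy]; first exact: D_h.
  rewrite G_h //; apply: le_trans (G_ge _ _ Dxy).
  by rewrite lerD2r; apply: minz; apply: D_fst Dxy.
split=> // x Cx; rewrite -(lerD2r c) -!G_h //.
by apply: minz; apply: D_h.
Qed.

Lemma hadamard_ystar (R : realType) (n : nat) (s : 'I_n -> R) (x : 'rV[R]_n) :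
  hadamard x (ystar s x) = 0.
Proof.
apply/rowP=> i; rewrite !mxE inE.
by case: eqVneq => [->|_]; rewrite ?mul0r ?mulr0.
Qed.

Lemma hadamard_eq0 {R : realType} {n : nat} {x y : 'rV[R]_n} {i : 'I_n} :
  hadamard x y = 0 -> x 0 i != 0 -> y 0 i = 0.
Proof.
move=> /rowP/(_ i); rewrite !mxE => /eqP.
by rewrite mulf_eq0 => /orP[->|/eqP].
Qed.

(** Writes the l0 term as a separable function, so that it can be compared with
    the penalty coordinate by coordinate. *)
Lemma norm0_sum (R : realType) (n : nat) (rho : R) (x : 'rV[R]_n) :
  rho * (norm0 x)%:R = \sum_i (if x 0 i == 0 then 0 else rho).
Proof.
rewrite /norm0 mulr_natr -sumr_const big_mkcond.
by apply: eq_bigr => i _; rewrite inE; case: eqP.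
Qed.

Lemma penalty_ystar {R : realType} {n : nat} {rho : R} {p : 'I_n -> R -> R}
    {s : 'I_n -> R} (p_P2 : forall i, P2 rho (p i) (s i)) (x : 'rV[R]_n) :
  penalty p (ystar s x) = rho * (norm0 x)%:R + \sum_i p i (s i).
Proof.
rewrite norm0_sum -big_split; apply: eq_bigr => i _ /=.
by rewrite mxE inE; case: eqP => _; rewrite ?add0r // -(p_P2 i) subrK.
Qed.

(** A coordinate with x_i = 0 costs at least the minimum p_i(s_i); one with
    x_i <> 0 costs exactly p_i(0), hence the surplus rho. *)
Lemma penalty_ge {R : realType} {n : nat} {rho : R} {p : 'I_n -> R -> R}
    {s : 'I_n -> R} {x y : 'rV[R]_n} (p_P2 : forall i, P2 rho (p i) (s i))
    (p_min : forall i t, p i (s i) <= p i t) (xy0 : hadamard x y = 0) :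
  rho * (norm0 x)%:R + \sum_i p i (s i) <= penalty p y.
Proof.
rewrite norm0_sum -big_split; apply: ler_sum => i _ /=.
case: eqVneq => [_|xi_neq0]; first by rewrite add0r.
by rewrite (hadamard_eq0 xy0 xi_neq0) -(p_P2 i) subrK.
Qed.

Theorem theorem3p4 (R : realType) (n : nat) (X : set 'rV[R]_n)
    (f : 'rV[R]_n -> R) (rho : R) (p : 'I_n -> R -> R) (s : 'I_n -> R)
    (X_nonempty : X !=set0) (X_closed : closed X)
    (f_C1 : continuously_differentiable f)
    (rho_gt0 : 0 < rho)
    (p_P1 : forall i, P1 (p i) (s i))
    (p_P2 : forall i, P2 rho (p i) (s i))
    (p_P3 : forall i, P3 (p i))
    (xstar : 'rV[R]_n) (Xxstar : X xstar) :
  SPO_solution X f rho xstar <-> SPOref_solution X f p xstar (ystar s xstar).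
Proof.
have p_min i t : p i (s i) <= p i t.
  by have [_ [[_ min_s] _] _] := p_P1 i; apply: min_s.
apply: (partial_min_global_min (ystar s) (\sum_i p i (s i))).
- by move=> x y [].
- by move=> x Xx; split=> //; apply: hadamard_ystar.
- by move=> x y [_ xy0]; rewrite -addrA lerD2l; apply: penalty_ge.
- by move=> x _; rewrite /SPOref_objective (penalty_ystar p_P2) addrA.
Qed.
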